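(* $\mathsf{SPT}^2_2 \not\le_{\rm sc} \mathsf{SIPT}^2_2$.
   Context: A 2-coloring of pairs is $f:[\omega]^2\to 2$, with $f(x,y)$ meaning $f(\{x,y\})$ for $x<y$; it is stable if $\lim_u f(x,u)$ exists for all $x$. $A\oplus B=\{2x:x\in A\}\cup\{2y+1:y\in B\}$. A set $H=H_L\oplus H_R$ with $H_L,H_R$ infinite is p-homogeneous for $f$ if $f(\{x,y\})$ is constant over $x\in H_L$, $y\in H_R$, $x\neq y$; it is increasing p-homogeneous for $f$ if $f(x,y)$ is constant over $x\in H_L$, $y\in H_R$, $x<y$. $\mathsf{SPT}^2_2$ (resp. $\mathsf{SIPT}^2_2$) is the problem whose instances are stable 2-colorings of pairs $f$ and whose solutions are sets p-homogeneous (resp. increasing p-homogeneous) for $f$. $\mathsf P\le_{\rm sc}\mathsf Q$ if every instance $X$ of $\mathsf P$ computes an instance $\widehat X$ of $\mathsf Q$ such that every solution $\widehat Y$ of $\widehat X$ computes some solution of $X$. *)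

(* Defs.v *)
From Stdlib Require Import Arith List.
Import ListNotations.

Definition oracle := nat -> nat -> nat.

Inductive prog : Type :=
| PZero : prog
| PSucc : prog
| PProj : nat -> prog
| POracle : prog
| PComp : prog -> list prog -> prog
| PRec : prog -> prog -> prog
| PMu : prog -> prog.

Inductive eval (o : oracle) : prog -> list nat -> nat -> Prop :=
| ev_zero : forall xs, eval o PZero xs 0
| ev_succ : forall xs, eval o PSucc xs (S (hd 0 xs))
| ev_proj : forall i xs, eval o (PProj i) xs (nth i xs 0)
| ev_oracle : forall xs, eval o POracle xs (o (nth 0 xs 0) (nth 1 xs 0))
| ev_comp : forall f gs xs ys z,
    Forall2 (fun g y => eval o g xs y) gs ys ->
    eval o f ys z -> eval o (PComp f gs) xs z
| ev_rec0 : forall f g xs z,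
    hd 0 xs = 0 -> eval o f (tl xs) z -> eval o (PRec f g) xs z
| ev_recS : forall f g xs n r z,
    hd 0 xs = S n -> eval o (PRec f g) (n :: tl xs) r ->
    eval o g (n :: r :: tl xs) z -> eval o (PRec f g) xs z
| ev_mu : forall f xs n,
    eval o f (n :: xs) 0 ->
    (forall m, m < n -> exists k, eval o f (m :: xs) (S k)) ->
    eval o (PMu f) xs n.

Definition computes (o o' : oracle) : Prop :=
  exists p : prog, forall x y, eval o p [x; y] (o' x y).

Definition set_oracle (A : nat -> bool) : oracle :=
  fun x _ => if A x then 1 else 0.

(* A 2-coloring of pairs f : [omega]^2 -> 2 is represented by
   c : nat -> nat -> bool where c x y (for x < y) is f({x,y});
   values of c x y with x >= y are irrelevant. *)
Definition coloring := nat -> nat -> bool.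

(* f({x,y}) for x <> y. *)
Definition colp (c : coloring) (x y : nat) : bool :=
  if x <? y then c x y else c y x.

(* Canonical oracle of a coloring (depends only on the values c x y, x < y). *)
Definition coloring_oracle (c : coloring) : oracle :=
  fun x y => if x =? y then 0 else if colp c x y then 1 else 0.

Definition stable (c : coloring) : Prop :=
  forall x, exists b N, forall u, N < u -> x < u -> c x u = b.

Definition infinite (A : nat -> bool) : Prop :=
  forall n, exists m, n <= m /\ A m = true.

Definition HL (H : nat -> bool) : nat -> bool := fun x => H (2 * x).
Definition HR (H : nat -> bool) : nat -> bool := fun y => H (2 * y + 1).

Definition p_homogeneous (c : coloring) (H : nat -> bool) : Prop :=
  infinite (HL H) /\ infinite (HR H) /\
  exists b, forall x y, HL H x = true -> HR H y = true -> x <> y ->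
    colp c x y = b.

Definition inc_p_homogeneous (c : coloring) (H : nat -> bool) : Prop :=
  infinite (HL H) /\ infinite (HR H) /\
  exists b, forall x y, HL H x = true -> HR H y = true -> x < y ->
    c x y = b.

Definition sc_reducible (solP solQ : coloring -> (nat -> bool) -> Prop) : Prop :=
  forall f, stable f ->
    exists g, stable g /\ computes (coloring_oracle f) (coloring_oracle g) /\
      forall Hg, solQ g Hg ->
        exists Hf, computes (set_oracle Hg) (set_oracle Hf) /\ solP f Hf.

Definition SPT22 := p_homogeneous.
Definition SIPT22 := inc_p_homogeneous.

(* Main.v *)
From Stdlib Require Import Arith Lia List Bool Classical ClassicalEpsilon Cantor.
Import ListNotations.
Require Import Defs.

(* Let f be generic for finite colorings together with promises about finitely many limits,
   let g be a stable coloring computed from f, and build solutions of g of both colors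
   simultaneously inside a common reservoir of candidates, so that for any two programs
   Psi_0, Psi_1 some color i has its solution H_i not taken by Psi_i to a set
   p-homogeneous for f.

   A pair (x, y) is killed when f(x, y), lim f(x) and lim f(y) are not all equal; outputting
   a killed pair is fatal. Suppose that no finite extension of the solutions outputs one.
   Extend the current condition in rounds, keeping all new limits of f undecided. In a round,
   first promise tentatively that all new points have limit 0, extend until the limits of g
   on an initial segment are forced, and choose there an element for the right half; then
   withdraw the promises made since the initial condition, and do the same with limit 1.
   Across rounds, f(x, y) depends only on the phase in which y was added. Three kinds of
   promises can then be made: all limits 0, all limits 1, or each limit opposite to the color
   of the phase of its point. By compactness they yield functions beta_0, beta_1 and beta_A
   that predict the limits of g. On an infinite part of the reservoir all three are constant.
   If beta_0 = beta_1 = i there, then between them the first two promises kill every pair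
   for color i. Otherwise beta_A = i agrees with beta_0 or beta_1, and the third promise kills
   every pair across rounds, while the right half is taken from the phases whose prediction
   is i. In both cases a set of color i in a suitably thinned reservoir that had infinite
   output on both halves would output a pair across rounds, hence one that can be killed. *)

(** * Oracle programs: induction, use, determinism and enumeration *)

Section EvalInduction.
Variables (o : oracle) (P : prog -> list nat -> nat -> Prop).
Hypotheses
  (Hzero : forall xs, P PZero xs 0)
  (Hsucc : forall xs, P PSucc xs (S (hd 0 xs)))
  (Hproj : forall i xs, P (PProj i) xs (nth i xs 0))
  (Horacle : forall xs, P POracle xs (o (nth 0 xs 0) (nth 1 xs 0)))
  (Hcomp : forall f gs xs ys z,
      Forall2 (fun g y => eval o g xs y /\ P g xs y) gs ys ->
      P f ys z -> P (PComp f gs) xs z)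
  (Hrec0 : forall f g xs z, hd 0 xs = 0 -> P f (tl xs) z -> P (PRec f g) xs z)
  (HrecS : forall f g xs n r z, hd 0 xs = S n ->
      P (PRec f g) (n :: tl xs) r -> P g (n :: r :: tl xs) z -> P (PRec f g) xs z)
  (Hmu : forall f xs n, P f (n :: xs) 0 ->
      (forall m, m < n -> exists k, P f (m :: xs) (S k)) -> P (PMu f) xs n).

(** Premises of [ev_comp] and [ev_mu] sit under [Forall2] and [exists]; this principle gives
    induction hypotheses for them as well. *)
Fixpoint eval_nested_ind p xs z (h : eval o p xs z) {struct h} : P p xs z.
Proof.
  destruct h as [xs|xs|i xs|xs|f gs xs ys z H h|f g xs z H h|f g xs n r z H h1 h2
                |f xs n h H].
  - apply Hzero.
  - apply Hsucc.
  - apply Hproj.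
  - apply Horacle.
  - refine (Hcomp _ _ _ _ _ _ (eval_nested_ind _ _ _ h)).
    clear h. induction H as [|g y gs ys Hgy _ IH]; constructor.
    + split; [exact Hgy|exact (eval_nested_ind _ _ _ Hgy)].
    + exact IH.
  - exact (Hrec0 _ _ _ _ H (eval_nested_ind _ _ _ h)).
  - exact (HrecS _ _ _ _ _ _ H (eval_nested_ind _ _ _ h1) (eval_nested_ind _ _ _ h2)).
  - refine (Hmu _ _ _ (eval_nested_ind _ _ _ h) _).
    intros m Hm. destruct (H m Hm) as [k hk]. exists k. exact (eval_nested_ind _ _ _ hk).
Qed.
End EvalInduction.

Definition agree (N : nat) (o o' : oracle) : Prop :=
  forall x y, x < N -> y < N -> o x y = o' x y.

Lemma agree_weaken N M o o' : M <= N -> agree N o o' -> agree M o o'.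
Proof. intros H A x y Hx Hy. apply A; lia. Qed.

(** A halting computation asks finitely many oracle questions; the bounds of its subcomputations are
    added up. *)
Lemma eval_use o p xs z : eval o p xs z ->
  exists N, forall o', agree N o o' -> eval o' p xs z.
Proof.
  intros h.
  induction h as [xs|xs|i xs|xs|f gs xs ys z H [N IH]|f g xs z H [N IH]
    |f g xs n r z H [N1 IH1] [N2 IH2]|f xs n [N IH] H] using eval_nested_ind.
  - exists 0. intros. constructor.
  - exists 0. intros. constructor.
  - exists 0. intros. constructor.
  - exists (S (nth 0 xs 0 + nth 1 xs 0)). intros o' A.
    rewrite (A (nth 0 xs 0) (nth 1 xs 0)) by lia. constructor.
  - assert (exists M, forall o', agree M o o' ->
      Forall2 (fun g y => eval o' g xs y) gs ys) as [M HM].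
    { clear IH. induction H as [|g y gs ys [_ [M HM]] _ [K HK]].
      - exists 0. constructor.
      - exists (M + K). intros o' A. constructor.
        + apply HM. apply (agree_weaken (M + K)); [lia|exact A].
        + apply HK. apply (agree_weaken (M + K)); [lia|exact A]. }
    exists (M + N). intros o' A. apply ev_comp with ys.
    + apply HM. apply (agree_weaken (M + N)); [lia|exact A].
    + apply IH. apply (agree_weaken (M + N)); [lia|exact A].
  - exists N. intros o' A. apply ev_rec0; auto.
  - exists (N1 + N2). intros o' A. apply ev_recS with n r; auto.
    + apply IH1. apply (agree_weaken (N1 + N2)); [lia|exact A].
    + apply IH2. apply (agree_weaken (N1 + N2)); [lia|exact A].
  - assert (exists M, forall o', agree M o o' ->
      forall m, m < n -> exists k, eval o' f (m :: xs) (S k)) as [M HM].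
    { clear IH. induction n as [|n IHn].
      - exists 0. intros. lia.
      - destruct IHn as [M HM]; [intros m Hm; apply H; lia|].
        destruct (H n) as [k [K HK]]; [lia|].
        exists (M + K). intros o' A m Hm.
        destruct (Nat.eq_dec m n) as [->|Hne].
        + exists k. apply HK. apply (agree_weaken (M + K)); [lia|exact A].
        + apply HM; [|lia]. apply (agree_weaken (M + K)); [lia|exact A]. }
    exists (M + N). intros o' A. apply ev_mu.
    + apply IH. apply (agree_weaken (M + N)); [lia|exact A].
    + apply HM. apply (agree_weaken (M + N)); [lia|exact A].
Qed.

Lemma eval_functional o p xs z : eval o p xs z -> forall z', eval o p xs z' -> z = z'.
Proof.
  intros h.
  induction h as [xs|xs|i xs|xs|f gs xs ys z H IH|f g xs z H IH
    |f g xs n r z H IH1 IH2|f xs n IH H] using eval_nested_ind;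
    intros z' h'; inversion h'; subst; auto; try congruence.
  - apply IH. replace ys with ys0; [assumption|].
    match goal with A : Forall2 _ gs ys0 |- _ => rename A into A0 end.
    clear - A0 H. revert ys0 A0.
    induction H as [|g y gs ys [_ Hy] _ IH]; intros ys0 A0; inversion A0; subst; auto.
    f_equal; auto. symmetry; auto.
  - assert (n0 = n) by congruence. subst.
    assert (r = r0) by (apply IH1; assumption). subst. apply IH2; assumption.
  - match goal with A : eval o f (z' :: xs) 0, B : forall m, m < z' -> _ |- _ =>
      rename A into A0; rename B into B0 end.
    destruct (lt_eq_lt_dec n z') as [[L|L]|L]; auto.
    + destruct (B0 n L) as [k hk]. specialize (IH _ hk). discriminate.
    + destruct (H z' L) as [k hk]. specialize (hk _ A0). discriminate.
Qed.

Fixpoint tuples (l : list prog) (d : nat) : list (list prog) :=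
  match d with
  | 0 => [[]]
  | S d => [] :: flat_map (fun a => map (cons a) (tuples l d)) l
  end.

(** [d] bounds nesting depth, projection indices and argument list lengths at once, so that each
    stage is finite and all stages together exhaust the syntax. *)
Fixpoint progs (d : nat) : list prog :=
  match d with
  | 0 => []
  | S d => [PZero; PSucc; POracle; PProj d] ++ progs d
      ++ flat_map (fun f => map (PComp f) (tuples (progs d) d)) (progs d)
      ++ flat_map (fun f => map (PRec f) (progs d)) (progs d)
      ++ map PMu (progs d)
  end.

Lemma progs_le d d' p : d <= d' -> In p (progs d) -> In p (progs d').
Proof.
  induction 1 as [|d' _ IH]; auto. intros Hp. simpl. do 4 right.
  apply in_or_app. left. auto.
Qed.

Lemma in_tuples l d gs : length gs <= d -> (forall g, In g gs -> In g l) -> In gs (tuples l d).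
Proof.
  revert gs. induction d as [|d IH]; intros [|g gs] Hl Hin; simpl in *; auto; try lia.
  right. apply in_flat_map. exists g. split; auto. apply in_map. apply IH; auto. lia.
Qed.

Fixpoint in_progs p : exists d, In p (progs d).
Proof.
  destruct p as [| |i| |f gs|f g|f].
  - exists 1. simpl. auto.
  - exists 1. simpl. auto.
  - exists (S i). simpl. auto.
  - exists 1. simpl. auto.
  - destruct (in_progs f) as [d Hd].
    assert (exists d', forall g, In g gs -> In g (progs d')) as [d' Hd'].
    { clear Hd. induction gs as [|g gs [d' IH]].
      - exists 0. intros g [].
      - destruct (in_progs g) as [k Hk]. exists (k + d'). intros h [<-|Hh].
        + apply (progs_le k); auto; lia.
        + apply (progs_le d'); auto; lia. }
    exists (S (d + d' + length gs)). simpl. do 4 right.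
    apply in_or_app. right. apply in_or_app. left. apply in_flat_map. exists f. split.
    + apply (progs_le d); auto; lia.
    + apply in_map, in_tuples; [lia|]. intros g Hg. apply (progs_le d'); auto; lia.
  - destruct (in_progs f) as [d Hd]. destruct (in_progs g) as [d' Hd'].
    exists (S (d + d')). simpl. do 4 right.
    apply in_or_app. right. apply in_or_app. right. apply in_or_app. left.
    apply in_flat_map. exists f. split.
    + apply (progs_le d); auto; lia.
    + apply in_map. apply (progs_le d'); auto; lia.
  - destruct (in_progs f) as [d Hd]. exists (S d). simpl. do 4 right.
    apply in_or_app. right. apply in_or_app. right. apply in_or_app. right.
    apply in_map. exact Hd.
Qed.

Definition prog_at (n : nat) : prog :=
  let (d, i) := of_nat n in nth i (progs d) PZero.

Lemma prog_at_surj p : exists n, prog_at n = p.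
Proof.
  destruct (in_progs p) as [d Hd]. destruct (In_nth _ _ PZero Hd) as [i [_ Hi]].
  exists (to_nat (d, i)). unfold prog_at. rewrite cancel_of_to. exact Hi.
Qed.

(** * Sequences by dependent choice, genericity and compactness *)

Lemma dependent_sequence (T : Type) (I : T -> Prop) (R : nat -> T -> T -> Prop) :
  (forall n s, I s -> exists s', I s' /\ R n s s') ->
  forall s0, I s0 -> exists u : nat -> T, u 0 = s0 /\ forall n, I (u n) /\ R n (u n) (u (S n)).
Proof.
  intros step s0 H0.
  assert (F : forall n (s : {s | I s}), {s' : {s | I s} | R n (proj1_sig s) (proj1_sig s')}).
  { intros n [s Hs]. apply constructive_indefinite_description.
    destruct (step n s Hs) as [s' [Hs' HR]]. exists (exist _ s' Hs'). exact HR. }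
  set (u := fix u n := match n with 0 => exist I s0 H0 | S n => proj1_sig (F n (u n)) end).
  exists (fun n => proj1_sig (u n)). split; [reflexivity|]. intros n. split.
  - exact (proj2_sig (u n)).
  - exact (proj2_sig (F n (u n))).
Qed.

Lemma monotone_sequence (T : Type) (le : T -> T -> Prop) (u : nat -> T) :
  (forall r s t, le r s -> le s t -> le r t) ->
  (forall n, le (u (S n)) (u n)) -> forall n m, n < m -> le (u m) (u n).
Proof. intros trans H n m. induction 1; eauto. Qed.

(* Rasiowa-Sikorski; meeting each dense set cofinally often lets one meet it again after
   any non-persistent side condition has settled. *)
Lemma generic_sequence (T : Type) (le : T -> T -> Prop) (I : T -> Prop)
    (D : nat -> T -> Prop) :
  (forall n s, I s -> exists s', I s' /\ le s' s /\ D n s') ->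
  forall s0, I s0 -> exists u : nat -> T,
    (forall n, I (u n) /\ le (u (S n)) (u n)) /\
    forall n K, exists k, K <= k /\ D n (u k).
Proof.
  intros dense s0 H0.
  destruct (dependent_sequence T I (fun k s s' => le s' s /\ D (fst (of_nat k)) s'))
    with (s0 := s0) as [u [_ Hu]].
  - intros n s Hs. destruct (dense (fst (of_nat n)) s Hs) as [s' ?]. exists s'. tauto.
  - exact H0.
  - exists u. split.
    + intros n. destruct (Hu n) as [? [? _]]. auto.
    + intros n K. exists (S (to_nat (n, K))). split.
      * pose proof (to_nat_non_decreasing n K). lia.
      * destruct (Hu (to_nat (n, K))) as [_ [_ H]]. rewrite cancel_of_to in H. exact H.
Qed.

Lemma pigeonhole (T : Type) (h : nat -> T) (l : list T) (P : nat -> Prop) :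
  (forall N, exists m, N <= m /\ P m /\ In (h m) l) ->
  exists b, forall N, exists m, N <= m /\ P m /\ h m = b.
Proof.
  induction l as [|b l IH]; intros H.
  - destruct (H 0) as [m [_ [_ []]]].
  - destruct (classic (forall N, exists m, N <= m /\ P m /\ h m = b)) as [?|Hb]; [eauto|].
    apply not_all_ex_not in Hb. destruct Hb as [N0 Hb].
    apply IH. intros N. destruct (H (N + N0)) as [m [Hm [HP [E|Hin]]]].
    + exfalso. apply Hb. exists m. repeat split; auto. lia.
    + exists m. repeat split; auto. lia.
Qed.

(** Compactness: a prefix that recurs infinitely often is lengthened by a value that keeps it
    recurrent. In a state [(M, b)] only the first [M] values of [b] count. *)
Lemma cluster_point (T : Type) (l : list T) (u : nat -> nat -> T) :
  (forall t, In t l) ->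
  exists beta, forall M N, exists m, N <= m /\ forall x, x < M -> u m x = beta x.
Proof.
  intros Hl.
  destruct (dependent_sequence (nat * (nat -> T))
    (fun s => forall N, exists m, N <= m /\ forall x, x < fst s -> u m x = snd s x)
    (fun _ s s' => fst s' = S (fst s) /\ forall x, x < fst s -> snd s' x = snd s x))
    with (s0 := (0, u 0)) as [w [Hw0 Hw]].
  - intros _ [M b] Hb. simpl in Hb.
    destruct (pigeonhole T (fun m => u m M) l
      (fun m => forall x, x < M -> u m x = b x)) as [t Ht].
    { intros N. destruct (Hb N) as [m [? ?]]. exists m. auto. }
    exists (S M, fun x => if x =? M then t else b x). simpl. repeat split.
    + intros N. destruct (Ht N) as [m [Hm [Hx Ht']]]. exists m. split; auto.
      intros x Hlt. destruct (Nat.eqb_spec x M); subst; auto. apply Hx. lia.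
    + intros x Hx. destruct (Nat.eqb_spec x M); auto. lia.
  - intros N. exists N. split; auto. simpl. intros. lia.
  - assert (Hlen : forall n, fst (w n) = n).
    { induction n as [|n IH]; [rewrite Hw0; auto|].
      destruct (Hw n) as [_ [E _]]. congruence. }
    assert (Hst : forall m n x, n <= m -> x < n -> snd (w m) x = snd (w n) x).
    { intros m n x. induction 1 as [|m Hm IH]; auto. intros Hx. rewrite <- IH; auto.
      destruct (Hw m) as [_ [_ E]]. apply E. rewrite Hlen. lia. }
    exists (fun x => snd (w (S x)) x). intros M N.
    destruct (Hw M) as [HM _]. destruct (HM N) as [m [? Hx]]. exists m. split; auto.
    intros x Hlt. rewrite Hx by (rewrite Hlen; auto). apply Hst; lia.
Qed.

(** * Conditions: finite colorings with promised limits *)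

(* A condition [p] promises the colors of all pairs below [len p], and that
   [lim p x] is the color of [{x, y}] for all [x < len p <= y]. *)
Record cond := Cond { len : nat; col : coloring; lim : nat -> bool }.

Definition extends (q p : cond) : Prop :=
  len p <= len q /\
  (forall x y, x < y -> y < len p -> col q x y = col p x y) /\
  (forall x, x < len p -> lim q x = lim p x) /\
  (forall x y, x < len p -> len p <= y -> y < len q -> col q x y = lim p x).

Definition meets (f : coloring) (p : cond) : Prop :=
  (forall x y, x < y -> y < len p -> f x y = col p x y) /\
  (forall x y, x < len p -> len p <= y -> f x y = lim p x).

Lemma extends_refl p : extends p p.
Proof. repeat split; auto; intros; lia. Qed.

Lemma extends_trans r q p : extends r q -> extends q p -> extends r p.
Proof.
  intros [L1 [C1 [M1 X1]]] [L2 [C2 [M2 X2]]]. repeat split.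
  - lia.
  - intros x y Hx Hy. rewrite C1, C2; auto. lia.
  - intros x Hx. rewrite M1, M2; auto. lia.
  - intros x y Hx Hy Hr. destruct (lt_dec y (len q)).
    + rewrite C1; auto. lia.
    + rewrite X1, M2; auto; lia.
Qed.

Lemma meets_extends f q p : extends q p -> meets f q -> meets f p.
Proof.
  intros [L [C [M X]]] [Fc Fl]. split.
  - intros x y Hx Hy. rewrite Fc, C; auto. lia.
  - intros x y Hx Hy. destruct (lt_dec y (len q)).
    + rewrite Fc; auto. lia.
    + rewrite Fl, M; auto; lia.
Qed.

Lemma meets_restrict f p N : meets f p -> len p <= N -> extends (Cond N f (lim p)) p.
Proof. intros [Fc Fl] HN. repeat split; simpl; auto. Qed.

Lemma meets_inhabited p : exists f, meets f p.
Proof.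
  exists (fun x y => if y <? len p then col p x y else lim p x).
  split; intros x y Hx Hy; destruct (Nat.ltb_spec y (len p)); auto; lia.
Qed.

Lemma extends_len p N : exists q, extends q p /\ N <= len q.
Proof.
  destruct (meets_inhabited p) as [f Hf]. exists (Cond (N + len p) f (lim p)).
  split; [apply meets_restrict; auto; lia|simpl; lia].
Qed.

(** * Functionals on conditions: decided, forced and locked values *)

Definition value (Phi : prog) (f : coloring) (x y v : nat) : Prop :=
  eval (coloring_oracle f) Phi [x; y] v.

Lemma agree_coloring N f f' :
  (forall x y, x < y -> y < N -> f x y = f' x y) ->
  agree N (coloring_oracle f) (coloring_oracle f').
Proof.
  intros H x y Hx Hy. unfold coloring_oracle, colp.
  destruct (Nat.eqb_spec x y); auto.
  destruct (Nat.ltb_spec x y); rewrite H; auto; lia.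
Qed.

Lemma agree_set N A A' :
  (forall x, x < N -> A x = A' x) -> agree N (set_oracle A) (set_oracle A').
Proof. intros H x y Hx _. unfold set_oracle. rewrite H; auto. Qed.

Definition decides (Phi : prog) (N : nat) (c : coloring) (x y v : nat) : Prop :=
  forall f, (forall a b, a < b -> b < N -> f a b = c a b) -> value Phi f x y v.

Lemma value_decides Phi f x y v : value Phi f x y v ->
  exists N0, forall N, N0 <= N -> decides Phi N f x y v.
Proof.
  intros H. destruct (eval_use _ _ _ _ H) as [N0 HN]. exists N0. intros N Hle f' Hf.
  apply HN. apply agree_weaken with N; auto. apply agree_coloring.
  intros a b Hab Hb. symmetry. auto.
Qed.

Lemma decides_mono Phi N N' c c' x y v : decides Phi N c x y v -> N <= N' ->
  (forall a b, a < b -> b < N -> c' a b = c a b) -> decides Phi N' c' x y v.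
Proof.
  intros H HN Hc f Hf. apply H. intros a b Hab Hb. rewrite Hf, Hc; auto. lia.
Qed.

Definition forces (Phi : prog) (p : cond) (x y : nat) (i : bool) : Prop :=
  forall f, meets f p -> forall v, value Phi f x y v -> v = Nat.b2n i.

Definition locks (Phi : prog) (p : cond) (x : nat) (i : bool) : Prop :=
  exists M, forall y, M <= y -> x < y -> forces Phi p x y i.

(** Two ways of keeping [Phi] from computing a stable coloring: a point whose limit no extension
    settles, so that genericity makes its colors oscillate, or a pair without a value. *)
Definition hopeless (Phi : prog) (p : cond) : Prop :=
  (exists x, forall q i, extends q p -> ~ locks Phi q x i) \/
  (exists x y, x < y /\ forall f v, meets f p -> ~ value Phi f x y v).

Definition good (Phi : prog) (p : cond) : Prop :=
  forall q, extends q p -> ~ hopeless Phi q.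

Lemma forces_mono Phi q p x y i : extends q p -> forces Phi p x y i -> forces Phi q x y i.
Proof. intros E H f Hf. apply H. eapply meets_extends; eauto. Qed.

Lemma locks_mono Phi q p x i : extends q p -> locks Phi p x i -> locks Phi q x i.
Proof.
  intros E [M H]. exists M. intros y Hy Hx. eapply forces_mono; eauto.
Qed.

Lemma good_mono Phi q p : extends q p -> good Phi p -> good Phi q.
Proof. intros E G r Hr. apply G. eapply extends_trans; eauto. Qed.

Lemma decides_forces Phi p x y i :
  decides Phi (len p) (col p) x y (Nat.b2n i) -> forces Phi p x y i.
Proof.
  intros D f Hf v Hv. symmetry. eapply eval_functional; [|exact Hv].
  apply D. apply (proj1 Hf).
Qed.

Section Good.
Variables (Phi : prog) (p : cond).
Hypothesis Hgood : good Phi p.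

Lemma good_locks q x : extends q p -> exists q' i, extends q' q /\ locks Phi q' x i.
Proof.
  intros E. apply NNPP. intros H. apply (Hgood q E). left. exists x.
  intros q' i E' L. apply H. eauto.
Qed.

Lemma good_value q x y : extends q p -> x < y -> exists f v, meets f q /\ value Phi f x y v.
Proof.
  intros E Hxy. apply NNPP. intros H. apply (Hgood q E). right. exists x, y.
  split; auto. intros f v Hf Hv. apply H. eauto.
Qed.

Lemma good_locks_below q m : extends q p ->
  exists q' beta, extends q' q /\ forall x, x < m -> locks Phi q' x (beta x).
Proof.
  intros E. induction m as [|m [q1 [b [E1 H1]]]].
  - exists q, (fun _ => false). split; [apply extends_refl|]. intros; lia.
  - destruct (good_locks q1 m) as [q2 [i [E2 H2]]]; [eapply extends_trans; eauto|].
    exists q2, (fun x => if x =? m then i else b x).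
    split; [eapply extends_trans; eauto|]. intros x Hx.
    destruct (Nat.eqb_spec x m); subst; auto.
    eapply locks_mono; [exact E2|]. apply H1. lia.
Qed.

(** Forcing only restricts values that converge. Goodness supplies, one [x] at a time, a coloring in
    which the value exists; forcing makes it the expected one, and its use fits into a longer
    condition. *)
Lemma good_decides_below q beta r m : extends q p ->
  (forall x, x < m -> x < r -> forces Phi q x r (beta x)) ->
  exists q', extends q' q /\
    forall x, x < m -> x < r -> decides Phi (len q') (col q') x r (Nat.b2n (beta x)).
Proof.
  intros E. induction m as [|m IH]; intros H.
  - exists q. split; [apply extends_refl|]. intros; lia.
  - destruct IH as [q1 [E1 H1]]; [intros; apply H; lia|].
    destruct (lt_dec m r) as [Hmr|Hmr].
    2: { exists q1. split; auto. intros x Hx Hr. apply H1; auto. lia. }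
    destruct (good_value q1 m r) as [f [v [Hf Hv]]]; auto; [eapply extends_trans; eauto|].
    assert (v = Nat.b2n (beta m)).
    { apply (H m) with f; auto. eapply meets_extends; eauto. }
    subst v. destruct (value_decides _ _ _ _ _ Hv) as [N0 HN].
    exists (Cond (N0 + len q1) f (lim q1)).
    assert (extends (Cond (N0 + len q1) f (lim q1)) q1) by
      (apply meets_restrict; auto; lia).
    split; [eapply extends_trans; eauto|]. intros x Hx Hr. simpl.
    destruct (Nat.eq_dec x m) as [->|Hne]; [apply HN; lia|].
    eapply decides_mono; [apply H1; lia|lia|]. apply (proj1 Hf).
Qed.

Lemma locks_uniform q beta m : (forall x, x < m -> locks Phi q x (beta x)) ->
  exists M, forall x y, x < m -> M <= y -> x < y -> forces Phi q x y (beta x).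
Proof.
  induction m as [|m IH]; intros H; [exists 0; intros; lia|].
  destruct IH as [M1 H1]; [auto|]. destruct (H m) as [M2 H2]; [lia|].
  exists (M1 + M2). intros x y Hx Hy Hxy. destruct (Nat.eq_dec x m) as [->|Hne].
  - apply H2; lia.
  - apply H1; lia.
Qed.

(** First the limits below [m] are locked, then [r] is taken beyond the point from which all these
    locks act, and last the values at [r] are decided. *)
Lemma good_phase q m (R : nat -> Prop) : extends q p -> (forall N, exists r, N <= r /\ R r) ->
  exists q' beta r, extends q' q /\ m <= len q' /\ R r /\ m <= r /\
    (forall x, x < m -> locks Phi q' x (beta x)) /\
    (forall x, x < m -> decides Phi (len q') (col q') x r (Nat.b2n (beta x))).
Proof.
  intros E HR. destruct (good_locks_below q m E) as [q1 [b [E1 H1]]].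
  destruct (locks_uniform q1 b m H1) as [M HM].
  destruct (HR (M + m)) as [r [Hr HRr]].
  destruct (good_decides_below q1 b r m) as [q2 [E2 H2]].
  { eapply extends_trans; eauto. }
  { intros x Hx Hxr. apply HM; lia. }
  destruct (extends_len q2 m) as [q3 [E3 L3]].
  assert (extends q3 q1) by (eapply extends_trans; eauto).
  exists q3, b, r.
  refine (conj _ (conj L3 (conj HRr (conj _ (conj _ _))))).
  - eapply extends_trans; eauto.
  - lia.
  - intros x Hx. eapply locks_mono; eauto.
  - intros x Hx. destruct E3 as [? [? _]]. eapply decides_mono; [apply H2; lia|auto|auto].
Qed.
End Good.

(** * Rounds: one growing coloring with promises made and withdrawn *)

Section Rounds.
Variables (Phi : prog) (p : cond) (R : nat -> Prop).
Hypotheses (Hgood : good Phi p) (HR : forall N, exists r, N <= r /\ R r).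

(** Promises made since [p] are replaced by [lambda]. If [v] extends [p], so does the result, but in
    general it does not extend [v]. *)
Definition relock (v : cond) (lambda : nat -> bool) : cond :=
  Cond (len v) (col v) (fun x => if x <? len p then lim p x else lambda x).

Lemma relock_extends q lambda : extends q p -> extends (relock q lambda) p.
Proof.
  intros [L [C [M X]]]. repeat split; simpl; auto.
  intros x Hx. destruct (Nat.ltb_spec x (len p)); auto; lia.
Qed.

(* In a round, [lim V] and [lim V'] are not promises: they tag each point with the color
   that older points take with it. Line [Some t] locks every new point to [t]; line [None]
   locks every new point to the color opposite to its tag. *)
Record round (m : nat) (V V' : cond) (q : option bool -> cond)
    (beta : option bool -> nat -> bool) (r : bool -> nat) : Prop := {
  round_len : len V <= len V';
  round_grow : S m <= len V';
  round_col : forall x y, x < y -> y < len V -> col V' x y = col V x y;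
  round_tag : forall y, y < len V -> lim V' y = lim V y;
  round_cross : forall x y, len p <= x -> x < len V -> len V <= y -> y < len V' ->
    col V' x y = lim V' y;
  round_extends : forall l, extends (q l) p;
  round_line_len : forall l, len V <= len (q l);
  round_line_col : forall l x y, x < y -> y < len V -> col (q l) x y = col V x y;
  round_line_lim : forall l y, len p <= y -> y < len V ->
    lim (q l) y = match l with Some t => t | None => negb (lim V y) end;
  round_locks : forall l x, x < m -> locks Phi (q l) x (beta l x);
  round_R : forall t, R (r t) /\ m <= r t;
  round_decides : forall t x, x < m ->
    decides Phi (len V') (col V') x (r t) (Nat.b2n (beta (Some t) x)) }.

Lemma round_exists m V : extends (relock V (lim V)) p ->
  exists V' q beta r, extends (relock V' (lim V')) p /\ round m V V' q beta r.
Proof.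
  intros HV.
  assert (Hre : forall lambda, extends (relock V lambda) p)
    by (intros; exact (relock_extends _ lambda HV)).
  destruct (good_phase Phi p Hgood _ m R (Hre (fun _ => false)) HR)
    as [q0 [b0 [r0 [E0 [G0 [R0 [M0 [L0 D0]]]]]]]].
  assert (E0p : extends q0 p) by (eapply extends_trans; eauto).
  destruct (good_phase Phi p Hgood _ (S m) R (relock_extends q0 (fun _ => true) E0p) HR)
    as [q1 [b1 [r1 [E1 [G1 [R1 [M1 [L1 D1]]]]]]]].
  assert (E1p : extends q1 p)
    by (eapply extends_trans; [exact E1|apply relock_extends; exact E0p]).
  destruct (good_locks_below Phi p Hgood _ m (Hre (fun y => negb (lim V y))))
    as [qA [bA [EA LA]]].
  assert (EAp : extends qA p) by (eapply extends_trans; eauto).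
  (* [V'] takes its colors from [q1], while [qA] is only a side branch. New points are tagged false
     below [len q0] and true from there on: their color with the older points since [p]. *)
  exists (Cond (len q1) (col q1) (fun y => if y <? len V then lim V y else len q0 <=? y)),
    (fun l => match l with Some false => q0 | Some true => q1 | None => qA end),
    (fun l => match l with Some false => b0 | Some true => b1 | None => bA end),
    (fun t : bool => if t then r1 else r0).
  split; [exact (relock_extends _ _ E1p)|].
  destruct E0 as [e0 [c0 [l0 x0]]], E1 as [e1 [c1 [l1 x1]]], EA as [eA [cA [lA xA]]].
  simpl in *.
  assert (HVp : len p <= len V) by (destruct HV; auto).
  constructor; simpl; auto.
  - lia.
  - intros x y Hx Hy. rewrite c1, c0; auto; lia.
  - intros y Hy. destruct (Nat.ltb_spec y (len V)); auto; lia.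
  - intros x y Hpx Hx Hy Hy'. destruct (Nat.ltb_spec y (len V)); [lia|].
    destruct (Nat.leb_spec (len q0) y).
    + rewrite x1 by lia. destruct (Nat.ltb_spec x (len p)); auto; lia.
    + rewrite c1, x0 by lia. destruct (Nat.ltb_spec x (len p)); auto; lia.
  - intros [[|]|]; auto.
  - intros [[|]|]; auto; lia.
  - intros [[|]|] x y Hx Hy; [rewrite c1, c0|rewrite c0|rewrite cA]; auto; lia.
  - intros [[|]|] y Hp Hy; [rewrite l1|rewrite l0|rewrite lA]; try lia;
      destruct (Nat.ltb_spec y (len p)); auto; lia.
  - intros [[|]|] x Hx; auto.
  - intros [|]; split; auto; lia.
  - intros [|] x Hx; auto.
    eapply decides_mono; [apply D0; auto|lia|]. intros; apply c1; auto.
Qed.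

Lemma rounds_exist : exists (v : nat -> cond) (q : nat -> option bool -> cond)
    (beta : nat -> option bool -> nat -> bool) (r : nat -> bool -> nat),
  forall m, round m (v m) (v (S m)) (q m) (beta m) (r m).
Proof.
  destruct (dependent_sequence
    (cond * ((option bool -> cond) * (option bool -> nat -> bool) * (bool -> nat)))
    (fun s => extends (relock (fst s) (lim (fst s))) p)
    (fun m s s' => round m (fst s) (fst s') (fst (fst (snd s'))) (snd (fst (snd s')))
      (snd (snd s'))))
    with (s0 := (p, ((fun _ : option bool => p), (fun (_ : option bool) (_ : nat) => false),
      (fun _ : bool => 0)))) as [u [_ Hu]].
  - intros m s Hs. destruct (round_exists m (fst s) Hs) as [V' [q [beta [r [HV Hr]]]]].
    exists (V', ((q, beta), r)). auto.
  - apply relock_extends, extends_refl.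
  - exists (fun m => fst (u m)), (fun m => fst (fst (snd (u (S m))))),
      (fun m => snd (fst (snd (u (S m))))), (fun m => snd (snd (u (S m)))).
    intros m. apply Hu.
Qed.

Variables (v : nat -> cond) (q : nat -> option bool -> cond)
  (beta : nat -> option bool -> nat -> bool) (r : nat -> bool -> nat).
Hypothesis Hround : forall m, round m (v m) (v (S m)) (q m) (beta m) (r m).

Lemma rounds_len m : m <= len (v m).
Proof. destruct m as [|m]; [lia|apply (round_grow _ _ _ _ _ _ (Hround m))]. Qed.

Lemma rounds_mono m m' : m <= m' -> len (v m) <= len (v m') /\
  (forall x y, x < y -> y < len (v m) -> col (v m') x y = col (v m) x y) /\
  (forall x y, len p <= x -> x < len (v m) -> len (v m) <= y -> y < len (v m') ->
    col (v m') x y = lim (v m') y).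
Proof.
  induction 1 as [|m' Hm [L [C X]]]; [repeat split; auto; intros; lia|].
  destruct (Hround m') as [RL _ RC RT RX _ _ _ _ _ _ _]. repeat split.
  - lia.
  - intros x y Hx Hy. rewrite RC, C; auto. lia.
  - intros x y Hp Hx Hy Hy'. destruct (lt_dec y (len (v m'))).
    + rewrite RC, RT, X; auto; lia.
    + apply RX; lia.
Qed.
End Rounds.

(** * Side states: approximations to solutions of both colors in a reservoir *)

(* A side state for one functional: finite approximations [E i] of a solution of color
   [i], decided below [bd] and to be continued inside [Zr]; all three sets code a left
   and a right half. *)
Record side := Side { E : bool -> nat -> bool; bd : nat; Zr : nat -> Prop }.

Definition inf2 (Z : nat -> Prop) : Prop :=
  (forall N, exists x, N <= x /\ Z (2 * x)) /\ (forall N, exists y, N <= y /\ Z (2 * y + 1)).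

(** The alternative [b <= 2 * r + 1] stands for right elements still to come: left elements already
    in [A] are committed to color [i] with these too. *)
Definition approximates (Phi : prog) (p : cond) (A : nat -> bool) (b : nat) (i : bool)
    : Prop :=
  (forall z, A z = true -> z < b) /\
  (forall x r, A (2 * x) = true -> x < r -> A (2 * r + 1) = true \/ b <= 2 * r + 1 ->
    forces Phi p x r i).

Definition side_ok (Phi : prog) (p : cond) (s : side) : Prop :=
  inf2 (Zr s) /\ forall i, approximates Phi p (E s i) (bd s) i.

Definition side_extends (s' s : side) : Prop :=
  bd s <= bd s' /\
  (forall i z, z < bd s -> E s' i z = E s i z) /\
  (forall i z, bd s <= z -> E s' i z = true -> Zr s z) /\
  (forall z, Zr s' z -> Zr s z).

Definition compatible (s : side) (i : bool) (A : nat -> bool) : Prop :=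
  (forall z, z < bd s -> A z = E s i z) /\
  (forall z, bd s <= z -> A z = true -> Zr s z).

Definition defeats (Psi : prog) (p : cond) (s : side) (i : bool) : Prop :=
  forall f A Hf, meets f p -> compatible s i A ->
    (forall x y, eval (set_oracle A) Psi [x; y] (set_oracle Hf x y)) ->
    ~ p_homogeneous f Hf.

Definition live (Phi : prog) (p : cond) (s : side) (i : bool) : Prop :=
  forall N, exists x, N <= x /\ Zr s (2 * x) /\ exists q, extends q p /\ locks Phi q x i.

Lemma side_extends_refl Phi p s : side_ok Phi p s -> side_extends s s.
Proof.
  intros [_ H]. repeat split; auto. intros i z Hz Ht.
  apply (proj1 (H i)) in Ht. lia.
Qed.

Lemma side_extends_trans s'' s' s :
  side_extends s'' s' -> side_extends s' s -> side_extends s'' s.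
Proof.
  intros [B1 [F1 [G1 Z1]]] [B2 [F2 [G2 Z2]]]. repeat split.
  - lia.
  - intros i z Hz. rewrite F1, F2; auto. lia.
  - intros i z Hz Ht. destruct (lt_dec z (bd s')).
    + apply G2 with i; auto. rewrite <- F1; auto.
    + apply Z2, G1 with i; auto. lia.
  - auto.
Qed.

(** Liveness passes from later states back to earlier ones, so once lost it stays lost. *)
Lemma live_mono Phi q p s' s i : extends q p -> side_extends s' s ->
  live Phi q s' i -> live Phi p s i.
Proof.
  intros E1 E2 L N. destruct (L N) as [x [Hx [Hz [q' [Hq Hl]]]]].
  exists x. repeat split; auto; [apply E2; auto|].
  exists q'. split; auto. eapply extends_trans; eauto.
Qed.

Lemma approximates_mono Phi q p A b b' i : extends q p -> b <= b' ->
  approximates Phi p A b i -> approximates Phi q A b' i.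
Proof.
  intros Eq Hb [H1 H2]. split.
  - intros z Hz. specialize (H1 z Hz). lia.
  - intros x r Hx Hr Hor. eapply forces_mono; [exact Eq|]. apply H2; auto.
    destruct Hor; auto. right. lia.
Qed.

Lemma side_ok_mono Phi q p s : extends q p -> side_ok Phi p s -> side_ok Phi q s.
Proof.
  intros Eq [H1 H2]. split; auto. intros i. eapply approximates_mono; eauto.
Qed.

(** A p-homogeneous output has some [x'] on the left and [y'] on the right beyond [len q]. Then
    [(x, y)], [(x, y')] and [(x', y)] share one color, and the last two have the promised limits of
    [x] and [y]. In [(x', y)] the left element is larger, so increasing p-homogeneity would not
    control it. *)
Lemma defeats_of_pair Psi q s i x y :
  x < y -> y < len q -> col q x y <> lim q x \/ col q x y <> lim q y ->
  (forall A, (forall z, z < bd s -> A z = E s i z) ->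
    eval (set_oracle A) Psi [2 * x; 0] 1 /\ eval (set_oracle A) Psi [2 * y + 1; 0] 1) ->
  defeats Psi q s i.
Proof.
  intros Hxy Hy Hkill Hout f A Hf [Fc Fl] [Hc _] Hev [IL [IR [c Hh]]].
  destruct (Hout A Hc) as [O1 O2].
  assert (Tx : HL Hf x = true).
  { pose proof (eval_functional _ _ _ _ (Hev (2 * x) 0) _ O1) as Ex.
    unfold set_oracle in Ex. unfold HL. destruct (Hf (2 * x)); auto; discriminate. }
  assert (Ty : HR Hf y = true).
  { pose proof (eval_functional _ _ _ _ (Hev (2 * y + 1) 0) _ O2) as Ey.
    unfold set_oracle in Ey. unfold HR. destruct (Hf (2 * y + 1)); auto; discriminate. }
  destruct (IL (len q)) as [x' [Hx' Tx']]. destruct (IR (len q)) as [y' [Hy' Ty']].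
  pose proof (Hh x y Tx Ty ltac:(lia)) as H1.
  pose proof (Hh x y' Tx Ty' ltac:(lia)) as H2.
  pose proof (Hh x' y Tx' Ty ltac:(lia)) as H3.
  unfold colp in H1, H2, H3.
  destruct (Nat.ltb_spec x y); [|lia]. destruct (Nat.ltb_spec x y'); [|lia].
  destruct (Nat.ltb_spec x' y); [lia|].
  rewrite Fc in H1 by lia. rewrite Fl in H2 by lia. rewrite Fl in H3 by lia.
  destruct Hkill as [K|K]; apply K; congruence.
Qed.

Lemma eventually_below (n : nat) (Q : nat -> nat -> Prop) :
  (forall j, j < n -> exists k, forall m, k <= m -> Q j m) ->
  exists k, forall m j, k <= m -> j < n -> Q j m.
Proof.
  induction n as [|n IH]; intros H; [exists 0; intros; lia|].
  destruct IH as [k1 H1]; [auto|]. destruct (H n) as [k2 H2]; [lia|].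
  exists (k1 + k2). intros m j Hm Hj. destruct (Nat.eq_dec j n) as [->|Hne].
  - apply H2. lia.
  - apply H1; lia.
Qed.

Definition set_side (s : side) (i : bool) (A : nat -> bool) (b : nat) : side :=
  Side (fun j => if eqb j i then A else E s j) b (Zr s).

Lemma set_side_ok Phi q p s i A b : side_ok Phi p s -> extends q p -> bd s <= b ->
  (forall z, z < bd s -> A z = E s i z) ->
  (forall z, bd s <= z -> A z = true -> Zr s z) -> approximates Phi q A b i ->
  side_extends (set_side s i A b) s /\ side_ok Phi q (set_side s i A b).
Proof.
  intros [Hinf Hold] Eq Hb HA HZ Hap. split.
  - repeat split; simpl; auto.
    + intros j z Hz. destruct (eqb_spec j i); subst; auto.
    + intros j z Hz. destruct (eqb_spec j i); subst; auto.
      intros Ht. apply (proj1 (Hold j)) in Ht. lia.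
  - split; simpl; auto. intros j. destruct (eqb_spec j i); subst; auto.
    eapply approximates_mono; eauto.
Qed.

(** * One step of diagonalization against two programs *)

Section Core.
Variables (Phi : prog) (p : cond) (s : side) (Psi : bool -> prog).
Hypotheses (Hgood : good Phi p) (Hok : side_ok Phi p s).

Definition winning (i : bool) (q : cond) (A : nat -> bool) (b : nat) : Prop :=
  extends q p /\ bd s <= b /\ (forall z, z < bd s -> A z = E s i z) /\
  (forall z, bd s <= z -> A z = true -> Zr s z) /\ approximates Phi q A b i /\
  exists x y, x < y /\ y < len q /\ (col q x y <> lim q x \/ col q x y <> lim q y) /\
    forall A', (forall z, z < b -> A' z = A z) ->
      eval (set_oracle A') (Psi i) [2 * x; 0] 1 /\
      eval (set_oracle A') (Psi i) [2 * y + 1; 0] 1.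

Lemma winning_defeats i q A b : winning i q A b ->
  exists s', extends q p /\ side_extends s' s /\ side_ok Phi q s' /\ defeats (Psi i) q s' i.
Proof.
  intros [Eq [Hb [HA [HZ [Hap [x [y [Hxy [Hy [Hk Hout]]]]]]]]]].
  exists (set_side s i A b). split; [exact Eq|].
  destruct (set_side_ok Phi q p s i A b) as [H1 H2]; auto. split; [|split]; auto.
  apply defeats_of_pair with x y; auto. simpl. rewrite eqb_reflx. auto.
Qed.

(** Left and right elements are chosen alternately in increasing order. The left elements below a
    right one are then at most the [x] chosen together with it, and there the values are decided. *)
Lemma core_thin_reservoir (v : nat -> cond) (t i : bool) (B : option bool -> nat -> bool)
    (good_x : nat -> Prop) :
  (forall K, exists x r, K <= x /\ x < r /\ good_x x /\ Zr s (2 * r + 1) /\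
    exists m, forall x', x' <= x ->
      decides Phi (len (v m)) (col (v m)) x' r (Nat.b2n (B (Some t) x'))) ->
  (forall x, good_x x -> Zr s (2 * x) /\ B (Some t) x = i) ->
  exists Z, inf2 Z /\ (forall z, Z z -> Zr s z) /\
    (forall x, Z (2 * x) -> bd s < x /\ good_x x) /\
    (forall r, Z (2 * r + 1) -> exists m, forall x, Z (2 * x) -> x < r ->
      decides Phi (len (v m)) (col (v m)) x r (Nat.b2n i)).
Proof.
  intros Hex Hgx.
  destruct (dependent_sequence (nat * nat) (fun _ => True)
    (fun _ a b => snd a < fst b /\ fst b < snd b /\ good_x (fst b) /\
      Zr s (2 * snd b + 1) /\ exists m, forall x', x' <= fst b ->
      decides Phi (len (v m)) (col (v m)) x' (snd b) (Nat.b2n (B (Some t) x'))))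
    with (s0 := (0, bd s)) as [u [Hu0 Hu]]; auto.
  { intros _ [a1 a2] _. destruct (Hex (S a2)) as [x [r [H1 H2]]].
    exists (x, r). simpl. split; auto. }
  assert (Hmono : forall j k, j < k -> snd (u j) < fst (u k) /\ fst (u k) < snd (u k)).
  { intros j k. induction 1 as [|k Hk IH].
    - destruct (Hu j) as [_ H]. tauto.
    - destruct (Hu k) as [_ H]. destruct H as [? [? _]]. lia. }
  assert (Hge : forall j, bd s + j <= snd (u j)).
  { induction j as [|j IH]; [rewrite Hu0; simpl; lia|].
    destruct (Hmono j (S j)); lia. }
  exists (fun z => exists j, z = 2 * fst (u (S j)) \/ z = 2 * snd (u (S j)) + 1).
  split; [split|split; [|split]].
  - intros N. exists (fst (u (S N))). split; [|exists N; auto].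
    destruct (Hmono N (S N)); auto. specialize (Hge N). lia.
  - intros N. exists (snd (u (S N))). split; [|exists N; auto].
    specialize (Hge (S N)). lia.
  - intros z [j [->| ->]]; destruct (Hu j) as [_ H]; [apply Hgx|]; tauto.
  - intros x [j [Hj|Hj]]; [|lia]. assert (x = fst (u (S j))) by lia. subst x.
    destruct (Hu j) as [_ [? [? [? _]]]]. split; auto. specialize (Hge j). lia.
  - intros r [j [Hj|Hj]]; [lia|]. assert (r = snd (u (S j))) by lia. subst r.
    destruct (Hu j) as [_ [_ [_ [_ [_ [m Hm]]]]]]. exists m.
    intros x [k [Hk|Hk]] Hlt; [|lia]. assert (x = fst (u (S k))) by lia. subst x.
    assert (k <= j).
    { destruct (le_lt_dec k j); auto. exfalso.
      destruct (Hmono (S j) (S k)); lia. }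
    destruct (Hu k) as [_ [_ [_ [Hgk _]]]]. rewrite <- (proj2 (Hgx _ Hgk)). apply Hm.
    destruct (Nat.eq_dec k j) as [->|Hne]; auto.
    destruct (Hmono (S k) (S j)); try lia. destruct (Hmono 0 (S k)); lia.
Qed.

(** Infinite output on both halves yields a pair [(x, y)] across rounds. In a late round all values
    among the used elements are decided and the locked limits agree with [B]; a line that kills the
    pair then turns the used part of [A] into a winning set. *)
Lemma core_defeats (v : nat -> cond) (q : nat -> option bool -> cond)
    (beta : nat -> option bool -> nat -> bool) (r : nat -> bool -> nat) (i : bool)
    (B : option bool -> nat -> bool) (good_x : nat -> Prop) (Z : nat -> Prop) :
  (forall m, round Phi p (fun r => Zr s (2 * r + 1)) m (v m) (v (S m)) (q m) (beta m) (r m)) ->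
  (forall M N, exists m, N <= m /\ forall x, x < M -> forall l, beta m l x = B l x) ->
  ((forall t x, good_x x -> B (Some t) x = i) \/ (forall x, good_x x -> B None x = i)) ->
  (forall z, Z z -> Zr s z) ->
  (forall x, Z (2 * x) -> bd s < x /\ good_x x) ->
  (forall r, Z (2 * r + 1) -> exists m, forall x, Z (2 * x) -> x < r ->
    decides Phi (len (v m)) (col (v m)) x r (Nat.b2n i)) ->
  (forall q A b, ~ winning i q A b) ->
  defeats (Psi i) p (Side (E s) (bd s) Z) i.
Proof.
  intros Hround Hclus Hline HZ Hxs Hdec Hnowin f A Hf Hm [Hcomp HcompZ] Hev [IL [IR _]].
  simpl in *.
  pose proof (rounds_mono _ _ _ _ _ _ _ Hround) as Hmono.
  pose proof (rounds_len _ _ _ _ _ _ _ Hround) as Hlen.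
  destruct (IL (len p)) as [x [Hx Tx]].
  (* [x < len (v (S x)) <= y] separates the two points by a round, so the color of the pair is the
     tag of [y]. *)
  destruct (IR (len (v (S x)))) as [y [Hy Ty]].
  pose proof (Hlen (S x)) as Hxlen.
  destruct (eval_use _ _ _ _ (Hev (2 * x) 0)) as [B1 U1].
  destruct (eval_use _ _ _ _ (Hev (2 * y + 1) 0)) as [B2 U2].
  set (Bd := B1 + B2 + bd s).
  destruct (eventually_below Bd (fun r m => Z (2 * r + 1) -> forall x, Z (2 * x) -> x < r ->
    decides Phi (len (v m)) (col (v m)) x r (Nat.b2n i))) as [k0 Hk0].
  { intros r0 _. destruct (classic (Z (2 * r0 + 1))) as [Hr0|]; [|exists 0; tauto].
    destruct (Hdec r0 Hr0) as [k Hk]. exists k. intros m Hkm _ x' Hx' Hlt.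
    destruct (Hmono k m Hkm) as [? [? _]]. eapply decides_mono; eauto. }
  (* Late enough for [beta m] to agree with [B] below [Bd], for the pairs below [Bd] to be decided,
     and for [v m] to contain [x] and [y]. *)
  destruct (Hclus Bd (Bd + k0 + S (S x) + S y)) as [m [Hm0 Hbeta]].
  pose proof (Hlen m) as Hmlen.
  destruct (Hround m) as [_ _ _ _ _ Rext Rlen Rcol Rlim Rlocks _ _].
  assert (exists l, (forall x', good_x x' -> B l x' = i) /\
    (col (q m l) x y <> lim (q m l) x \/ col (q m l) x y <> lim (q m l) y)) as [l [Hl Hkill]].
  { destruct Hline as [Hs|Hn].
    (* Both constant lines predict [i], so the one opposite to the color of the pair may be taken;
       it makes the limit of [x] differ from that color. *)
    - exists (Some (negb (col (v m) x y))). split; auto. left.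
      rewrite Rcol, Rlim by lia. destruct (col (v m) x y); discriminate.
    (* The color of the pair is the tag of [y], and line [None] gives [y] the opposite limit. *)
    - exists None. split; auto. right. rewrite Rcol, Rlim by lia.
      destruct (Hmono (S x) m) as [_ [_ X]]; [lia|]. rewrite X by lia.
      destruct (lim (v m) y); discriminate. }
  destruct (locks_uniform Phi (q m l) (beta m l) m (Rlocks l)) as [M HM].
  destruct Hok as [_ Hold].
  (* With this bound a later right element [r'] satisfies [M <= r'], where the locks of the line
     act. *)
  apply (Hnowin (q m l) (fun z => (z <? Bd) && A z) (Bd + 2 * M + 1)).
  assert (HA : forall z, z < Bd -> (z <? Bd) && A z = A z).
  { intros z Hz. destruct (Nat.ltb_spec z Bd); auto; lia. }
  assert (HA' : forall z, (z <? Bd) && A z = true -> z < Bd /\ A z = true).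
  { intros z Hz. apply andb_prop in Hz. destruct Hz as [Hz1 Hz2].
    apply Nat.ltb_lt in Hz1. auto. }
  unfold winning. repeat split; try lia; auto; try apply Rext.
  - intros z Hz. rewrite HA by lia. auto.
  - intros z Hz Ht. apply HA' in Ht. apply HZ, HcompZ; tauto.
  - intros z Ht. apply HA' in Ht. lia.
  - intros x' r' Hx' Hlt Hor. apply HA' in Hx'. destruct Hx' as [Hx' Ax'].
    destruct (le_lt_dec (bd s) (2 * x')) as [Hnew|Hnew].
    + assert (Zx : Z (2 * x')) by (apply HcompZ; auto).
      destruct (Hxs x' Zx) as [Hbx Hgx]. destruct Hor as [Hr|Hr].
      * apply HA' in Hr. destruct Hr as [Hr Ar].
        assert (Zr' : Z (2 * r' + 1)) by (apply HcompZ; auto; lia).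
        apply decides_forces. eapply decides_mono.
        -- apply (Hk0 m r'); auto; lia.
        -- apply Rlen.
        -- intros a b Hab Hb. apply Rcol; auto.
      * rewrite <- (Hl x' Hgx), <- Hbeta by lia. apply HM; lia.
    + assert (Ex' : E s i (2 * x') = true) by (rewrite <- Hcomp; auto).
      eapply forces_mono; [apply Rext|]. apply (proj2 (Hold i) x' r'); auto.
      destruct Hor as [Hr|Hr]; [|right; lia].
      apply HA' in Hr. destruct Hr as [Hr Ar].
      destruct (le_lt_dec (bd s) (2 * r' + 1)); auto. left. rewrite <- Hcomp; auto.
  - exists x, y. split; [lia|]. split; [specialize (Rlen l); lia|]. split; [exact Hkill|].
    intros A' HA1.
    assert (Hag : forall z, z < Bd -> A z = A' z).
    { intros z Hz. rewrite HA1, HA; auto. lia. }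
    unfold HL in Tx. unfold HR in Ty.
    assert (V1 : set_oracle Hf (2 * x) 0 = 1) by (unfold set_oracle; rewrite Tx; auto).
    assert (V2 : set_oracle Hf (2 * y + 1) 0 = 1) by (unfold set_oracle; rewrite Ty; auto).
    rewrite V1 in U1. rewrite V2 in U2.
    split; [apply U1|apply U2]; apply agree_set; intros z Hz; apply Hag; unfold Bd; lia.
Qed.

(** A winning set for a live color is taken at once. If there is none, the predictions select a
    color that is live, and thinning the reservoir defeats its program. *)
Lemma core : exists q s' i,
  extends q p /\ side_extends s' s /\ side_ok Phi q s' /\ defeats (Psi i) q s' i /\
  live Phi p s i.
Proof.
  destruct (classic (exists i q A b, live Phi p s i /\ winning i q A b))
    as [[i [q [A [b [HL Hw]]]]]|Hnowin].
  { destruct (winning_defeats _ _ _ _ Hw) as [s' Hs']. exists q, s', i. tauto. }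
  destruct (proj1 Hok) as [ZL ZR].
  destruct (rounds_exist Phi p (fun r => Zr s (2 * r + 1)) Hgood ZR)
    as [v [q [beta [r Hround]]]].
  set (all := list_prod (list_prod [false; true] [false; true]) [false; true]).
  assert (Hall : forall t, In t all).
  { intros [[[|] [|]] [|]]; simpl; tauto. }
  destruct (cluster_point _ all
    (fun m x => ((beta m (Some false) x, beta m (Some true) x), beta m None x)) Hall)
    as [b Hb].
  set (B := fun l x => match l with
    | Some false => fst (fst (b x)) | Some true => snd (fst (b x)) | None => snd (b x) end).
  assert (Hclus : forall M N, exists m, N <= m /\
    forall x, x < M -> forall l, beta m l x = B l x).
  { intros M N. destruct (Hb M N) as [m [Hm Hx]]. exists m. split; auto.
    intros x Hlt l. specialize (Hx x Hlt). unfold B. rewrite <- Hx.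
    destruct l as [[|]|]; auto. }
  destruct (pigeonhole _ b all (fun x => Zr s (2 * x))) as [[[b0 b1] bA] Htype].
  { intros N. destruct (ZL N) as [x [? ?]]. exists x. auto. }
  set (good_x := fun x => Zr s (2 * x) /\ b x = ((b0, b1), bA)).
  (* If the two constant lines agree, they kill every pair between them; otherwise one
     of them agrees with line [None]. *)
  assert (exists i t, (forall x, good_x x -> B (Some t) x = i) /\
    ((forall t x, good_x x -> B (Some t) x = i) \/ (forall x, good_x x -> B None x = i)))
    as [i [t [Ht Hline]]].
  { unfold good_x, B. destruct (bool_dec b0 b1) as [<-|Hne].
    - exists b0, true. split; [|left; intros [|]]; intros x [_ ->]; auto.
    - exists bA. destruct (bool_dec b0 bA) as [<-|HneA].
      + exists false. split; [|right]; intros x [_ ->]; auto.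
      + exists true. split; [|right]; intros x [_ ->]; auto; simpl.
        destruct b0, b1, bA; congruence. }
  assert (Hlive : live Phi p s i).
  { intros N. destruct (Htype N) as [x [HN [HZ Hbx]]]. exists x. split; auto. split; auto.
    destruct (Hclus (S x) (S x)) as [m [Hm Hx]].
    exists (q m (Some t)). split; [apply (round_extends _ _ _ _ _ _ _ _ _ (Hround m))|].
    rewrite <- (Ht x); [|split; auto]. rewrite <- Hx by lia.
    apply (round_locks _ _ _ _ _ _ _ _ _ (Hround m)). lia. }
  destruct (core_thin_reservoir v t i B good_x) as [Z [Zinf [HZ [Hxs Hdec]]]].
  { intros K. destruct (Htype K) as [x [HK [HZ Hbx]]].
    destruct (Hclus (S x) (S x)) as [m [Hm Hx]].
    destruct (round_R _ _ _ _ _ _ _ _ _ (Hround m) t) as [HR HRm].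
    exists x, (r m t). repeat split; auto; try lia.
    exists (S m). intros x' Hx'. rewrite <- Hx by lia.
    apply (round_decides _ _ _ _ _ _ _ _ _ (Hround m)). lia. }
  { intros x Hx. split; [apply Hx|auto]. }
  exists p, (Side (E s) (bd s) Z), i. split; [apply extends_refl|].
  split; [|split; [|split]]; auto.
  - destruct (side_extends_refl _ _ _ Hok) as [? [? [? ?]]]. repeat split; auto.
  - split; auto. apply Hok.
  - eapply core_defeats; eauto. intros q' A b' Hw. apply Hnowin. exists i, q', A, b'. auto.
Qed.
End Core.

(** [core] ensures liveness only before its extension. If its color dies, a second application finds
    a color still live then, hence the other one. Both cannot be dead, since goodness lets any left
    candidate be locked to some color. *)
Lemma core_live Phi p s (Psi : bool -> prog) : good Phi p -> side_ok Phi p s ->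
  exists q s' i, extends q p /\ side_extends s' s /\ side_ok Phi q s' /\
    live Phi q s' i /\ defeats (Psi i) q s' i.
Proof.
  intros G Hok.
  destruct (core Phi p s Psi G Hok) as [q1 [s1 [i [Eq1 [Es1 [Hok1 [D1 _]]]]]]].
  destruct (classic (live Phi q1 s1 i)) as [L1|L1]; [exists q1, s1, i; auto 6|].
  pose proof (good_mono _ _ _ Eq1 G) as G1.
  destruct (core Phi q1 s1 Psi G1 Hok1) as [q2 [s2 [j [Eq2 [Es2 [Hok2 [D2 L2]]]]]]].
  destruct (classic (live Phi q2 s2 j)) as [L3|L3].
  { exists q2, s2, j. split; [eapply extends_trans; eauto|].
    split; [eapply side_extends_trans; eauto|auto]. }
  exfalso.
  assert (L4 : ~ live Phi q2 s2 i) by (intro L; apply L1; eapply live_mono; eauto).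
  assert (Hall : forall k, ~ live Phi q2 s2 k).
  { intros k. assert (k = i \/ k = j) as [->| ->]; auto.
    destruct (bool_dec i j); [subst; contradiction|]. destruct i, j, k; auto; congruence. }
  destruct (not_all_ex_not _ _ (Hall true)) as [N1 H1].
  destruct (not_all_ex_not _ _ (Hall false)) as [N2 H2].
  destruct (proj1 (proj1 Hok2) (N1 + N2)) as [x [Hx HZ]].
  destruct (good_locks Phi q2 (good_mono _ _ _ Eq2 G1) q2 x (extends_refl _))
    as [q3 [[|] [Eq3 Hl]]]; [apply H1|apply H2]; exists x; repeat split; eauto; lia.
Qed.

(** * Requirements and their density: growth, oscillation and defeat *)

Definition reaches (A : nat -> bool) (N : nat) : Prop :=
  (exists x, N <= x /\ A (2 * x) = true) /\ (exists y, N <= y /\ A (2 * y + 1) = true).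

(** The new right element is taken past [bd s] and past the bound [M] of the lock on the new left
    element [x]; old left elements are committed to color [i] with everything past [bd s]. *)
Lemma live_grows Phi p s i N : side_ok Phi p s -> live Phi p s i ->
  exists q s', extends q p /\ side_extends s' s /\ side_ok Phi q s' /\ reaches (E s' i) N.
Proof.
  intros Hok L. destruct (L (N + bd s)) as [x [Hx [HZ [q [Eq [M HM]]]]]].
  pose proof Hok as [Hinf Hold].
  destruct (proj2 Hinf (N + bd s + M + x + 1)) as [r [Hr HZr]].
  set (A := fun z => E s i z || (z =? 2 * x) || (z =? 2 * r + 1)).
  assert (HA : forall z, A z = true -> E s i z = true \/ z = 2 * x \/ z = 2 * r + 1).
  { intros z Hz. unfold A in Hz. apply orb_prop in Hz. destruct Hz as [Hz|Hz].
    - apply orb_prop in Hz. destruct Hz as [Hz|Hz]; auto. apply Nat.eqb_eq in Hz. auto.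
    - apply Nat.eqb_eq in Hz. auto. }
  destruct (Hold i) as [Hbd Hforce].
  exists q, (set_side s i A (2 * r + 2)). split; [exact Eq|].
  destruct (set_side_ok Phi q p s i A (2 * r + 2)) as [H1 H2]; auto; try lia.
  - intros z Hz. unfold A. destruct (Nat.eqb_spec z (2 * x)); [lia|].
    destruct (Nat.eqb_spec z (2 * r + 1)); [lia|]. destruct (E s i z); auto.
  - intros z Hz Ht. destruct (HA z Ht) as [Ht'|[->| ->]]; auto.
    apply Hbd in Ht'. lia.
  - split.
    + intros z Hz. destruct (HA z Hz) as [Hz'|Hz']; [apply Hbd in Hz'; lia|lia].
    + intros x' r' Hx' Hlt Hr'.
      assert (E s i (2 * r' + 1) = true \/ bd s <= 2 * r' + 1 /\ r <= r') as Hor.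
      { destruct Hr' as [Hr'|Hr']; [|right; lia].
        destruct (HA _ Hr') as [?|[?|?]]; auto; right; lia. }
      destruct (HA _ Hx') as [Hx0|[Hx0|Hx0]]; [| |lia].
      * eapply forces_mono; [exact Eq|]. apply Hforce; auto. tauto.
      * assert (x' = x) by lia. subst x'. destruct Hor as [Hor|Hor]; [|apply HM; lia].
        apply Hbd in Hor. lia.
  - split; [|split]; auto. simpl. rewrite eqb_reflx. split; [exists x|exists r].
    + split; [lia|]. unfold A. rewrite Nat.eqb_refl, orb_true_r. auto.
    + split; [lia|]. unfold A. rewrite Nat.eqb_refl, orb_true_r. auto.
Qed.

Definition oscillates (Phi : prog) (p : cond) (x M : nat) (i : bool) : Prop :=
  (exists q j, extends q p /\ locks Phi q x j) \/
  exists y, M <= y /\ x < y /\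
    forall f, meets f p -> exists v, v <> Nat.b2n i /\ value Phi f x y v.

(** If no extension locks [x], then [p] does not lock it to [i]: some coloring meeting [p] has a
    wrong value beyond [M], and a finite part of it decides that value. *)
Lemma oscillates_dense Phi p x M i : exists q, extends q p /\ oscillates Phi q x M i.
Proof.
  destruct (classic (exists q j, extends q p /\ locks Phi q x j)) as [H|H].
  { exists p. split; [apply extends_refl|left; auto]. }
  assert (~ locks Phi p x i) as HL
    by (intro L; apply H; exists p, i; split; auto; apply extends_refl).
  apply not_ex_all_not with (n := M) in HL. apply not_all_ex_not in HL.
  destruct HL as [y HL]. apply imply_to_and in HL. destruct HL as [HM HL].
  apply imply_to_and in HL. destruct HL as [Hxy HL].
  apply not_all_ex_not in HL. destruct HL as [f HL].
  apply imply_to_and in HL. destruct HL as [Hf HL].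
  apply not_all_ex_not in HL. destruct HL as [v HL].
  apply imply_to_and in HL. destruct HL as [Hv Hne].
  destruct (value_decides _ _ _ _ _ Hv) as [N0 HN].
  exists (Cond (N0 + len p) f (lim p)). split; [apply meets_restrict; auto; lia|].
  right. exists y. repeat split; auto. intros f' [Hf' _]. exists v. split; auto.
  apply (HN (N0 + len p)); auto. lia.
Qed.

Inductive requirement : Type :=
| Longer (N : nat)
| Oscillate (e x M : nat) (i : bool)
| Defeat (e j k : nat)
| Grow (e N : nat) (i : bool).

Definition requirement_at (n : nat) : requirement :=
  let (t, a) := of_nat n in let (e, b) := of_nat a in let (j, k) := of_nat b in
  match t with
  | 0 => Longer e
  | 1 => Oscillate e j k false
  | 2 => Oscillate e j k true
  | 3 => Defeat e j k
  | 4 => Grow e j false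
  | _ => Grow e j true
  end.

Lemma requirement_at_surj r : exists n, requirement_at n = r.
Proof.
  assert (forall t e j k, exists n, requirement_at n =
    match t with
    | 0 => Longer e
    | 1 => Oscillate e j k false
    | 2 => Oscillate e j k true
    | 3 => Defeat e j k
    | 4 => Grow e j false
    | _ => Grow e j true
    end) as H.
  { intros t e j k. exists (to_nat (t, to_nat (e, to_nat (j, k)))).
    unfold requirement_at. rewrite !cancel_of_to. reflexivity. }
  destruct r as [N|e x M [|]|e j k|e N [|]];
    [apply (H 0 N 0 0)|apply (H 2)|apply (H 1)|apply (H 3)
    |apply (H 5 e N 0)|apply (H 4 e N 0)].
Qed.

Definition state : Type := cond * (nat -> side).

Definition state_ok (s : state) : Prop := forall e, side_ok (prog_at e) (fst s) (snd s e).

Definition state_extends (s' s : state) : Prop :=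
  extends (fst s') (fst s) /\ forall e, side_extends (snd s' e) (snd s e).

(** [Defeat] carries one program per color because [core_live] does not let the color be
    prescribed. *)
Definition fulfills (r : requirement) (s : state) : Prop :=
  let (p, S) := s in
  match r with
  | Longer N => N <= len p
  | Oscillate e x M i => oscillates (prog_at e) p x M i
  | Defeat e j k => hopeless (prog_at e) p \/
      exists i, live (prog_at e) p (S e) i /\
        defeats (prog_at (if i : bool then k else j)) p (S e) i
  | Grow e N i => live (prog_at e) p (S e) i -> reaches (E (S e) i) N
  end.

Lemma state_extends_trans s'' s' s :
  state_extends s'' s' -> state_extends s' s -> state_extends s'' s.
Proof.
  intros [H1 H2] [H3 H4]. split; [eapply extends_trans; eauto|].
  intros e. eapply side_extends_trans; eauto.
Qed.

Lemma state_update p S q e s : state_ok (p, S) -> extends q p ->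
  side_extends s (S e) -> side_ok (prog_at e) q s ->
  let s' := (q, fun d => if d =? e then s else S d) in
  state_ok s' /\ state_extends s' (p, S).
Proof.
  intros Hok Eq Es Hs. split.
  - intros d. simpl. destruct (Nat.eqb_spec d e); subst; auto.
    exact (side_ok_mono _ _ _ _ Eq (Hok d)).
  - split; auto. intros d. simpl. destruct (Nat.eqb_spec d e); subst; auto.
    exact (side_extends_refl _ _ _ (Hok d)).
Qed.

Lemma state_lengthen p S q : state_ok (p, S) -> extends q p ->
  state_ok (q, S) /\ state_extends (q, S) (p, S).
Proof.
  intros Hok Eq. split.
  - intros d. exact (side_ok_mono _ _ _ _ Eq (Hok d)).
  - split; auto. intros d. exact (side_extends_refl _ _ _ (Hok d)).
Qed.

Lemma fulfills_dense r s : state_ok s ->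
  exists s', state_ok s' /\ state_extends s' s /\ fulfills r s'.
Proof.
  destruct s as [p S]. intros Hok. destruct r as [N|e x M i|e j k|e N i].
  - destruct (extends_len p N) as [q [Eq HN]]. exists (q, S).
    destruct (state_lengthen p S q Hok Eq). auto.
  - destruct (oscillates_dense (prog_at e) p x M i) as [q [Eq Ho]]. exists (q, S).
    destruct (state_lengthen p S q Hok Eq). auto.
  - destruct (classic (exists q, extends q p /\ hopeless (prog_at e) q)) as [[q [Eq Hh]]|Hn].
    { exists (q, S). destruct (state_lengthen p S q Hok Eq). simpl. auto. }
    assert (G : good (prog_at e) p) by (intros q Eq Hh; apply Hn; eauto).
    destruct (core_live _ _ _ (fun i : bool => prog_at (if i then k else j)) G (Hok e))
      as [q [s' [i [Eq [Es [Hs [HL HD]]]]]]].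
    destruct (state_update p S q e s' Hok Eq Es Hs) as [H1 H2].
    eexists. split; [exact H1|split; [exact H2|]]. simpl. right. exists i.
    rewrite Nat.eqb_refl. auto.
  - destruct (classic (live (prog_at e) p (S e) i)) as [HL|HL].
    + destruct (live_grows _ _ _ _ N (Hok e) HL) as [q [s' [Eq [Es [Hs HR]]]]].
      destruct (state_update p S q e s' Hok Eq Es Hs) as [H1 H2].
      eexists. split; [exact H1|split; [exact H2|]]. simpl.
      rewrite Nat.eqb_refl. auto.
    + exists (p, S). destruct (state_lengthen p S p Hok (extends_refl p)).
      split; [|split]; auto. simpl. tauto.
Qed.

(** * The generic coloring and the limits of the side states *)

Section Limit.
Variable u : nat -> state.
Hypotheses (Hok : forall k, state_ok (u k))
  (Hstep : forall k, state_extends (u (S k)) (u k))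
  (Hful : forall r K, exists k, K <= k /\ fulfills r (u k)).

Lemma limit_mono k m : k < m -> state_extends (u m) (u k).
Proof. apply monotone_sequence; auto. apply state_extends_trans. Qed.

Lemma limit_extends k m : k <= m -> extends (fst (u m)) (fst (u k)).
Proof.
  intros H. destruct (Nat.eq_dec k m) as [->|]; [apply extends_refl|].
  apply limit_mono. lia.
Qed.

Lemma limit_side_extends k m e : k <= m -> side_extends (snd (u m) e) (snd (u k) e).
Proof.
  intros H. destruct (Nat.eq_dec k m) as [->|].
  - eapply side_extends_refl. apply (Hok m).
  - apply limit_mono. lia.
Qed.

Lemma limit_len N : exists k, N < len (fst (u k)).
Proof.
  destruct (Hful (Longer (S N)) 0) as [k [_ H]]. exists k. unfold fulfills in H.
  destruct (u k). exact H.
Qed.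

Lemma limit_coloring : exists f, forall k, meets f (fst (u k)).
Proof.
  exists (fun x y =>
    col (fst (u (proj1_sig (constructive_indefinite_description _ (limit_len y))))) x y).
  intros k. split; intros x y Hx Hy;
    destruct (constructive_indefinite_description _ (limit_len y)) as [m Hm]; simpl.
  - destruct (le_lt_dec k m) as [L|L].
    + apply (limit_extends k m L); auto.
    + symmetry. apply (limit_extends m k); auto. lia.
  - destruct (le_lt_dec k m) as [L|L].
    + apply (limit_extends k m L); auto.
    + pose proof (proj1 (limit_extends m k ltac:(lia))). lia.
Qed.

Lemma limit_stable f : (forall k, meets f (fst (u k))) -> stable f.
Proof.
  intros Hf x. destruct (limit_len x) as [k Hk].
  exists (lim (fst (u k)) x), (len (fst (u k))). intros y Hy _.
  apply (Hf k); auto. lia.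
Qed.

Definition limit_set (e : nat) (i : bool) (z : nat) : bool :=
  if excluded_middle_informative (exists k, E (snd (u k) e) i z = true) then true else false.

Lemma limit_set_true e i z :
  limit_set e i z = true <-> exists k, E (snd (u k) e) i z = true.
Proof.
  unfold limit_set. destruct (excluded_middle_informative _); split; auto; discriminate.
Qed.

Lemma limit_set_compatible e i k : compatible (snd (u k) e) i (limit_set e i).
Proof.
  assert (Hbd : forall m z, E (snd (u m) e) i z = true -> z < bd (snd (u m) e)).
  { intros m z. apply (proj1 (proj2 (Hok m e) i)). }
  split.
  - intros z Hz. apply eq_true_iff_eq. rewrite limit_set_true. split; [|eauto].
    intros [m Hm]. destruct (le_lt_dec k m) as [L|L].
    + destruct (limit_side_extends k m e L) as [_ [F _]]. rewrite <- F; auto.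
    + destruct (limit_side_extends m k e) as [_ [F _]]; [lia|]. rewrite F; auto.
  - intros z Hz Ht. apply limit_set_true in Ht. destruct Ht as [m Hm].
    destruct (le_lt_dec k m) as [L|L].
    + destruct (limit_side_extends k m e L) as [_ [_ [G _]]]. apply G with i; auto.
    + pose proof (proj1 (limit_side_extends m k e ltac:(lia))).
      apply Hbd in Hm. lia.
Qed.

Variables (f g : coloring) (e : nat).
Hypotheses (Hf : forall k, meets f (fst (u k))) (Hg : stable g)
  (Hfg : forall x y, eval (coloring_oracle f) (prog_at e) [x; y] (coloring_oracle g x y)).

Lemma limit_value x y : x < y -> value (prog_at e) f x y (Nat.b2n (g x y)).
Proof.
  intros Hxy. unfold value.
  replace (Nat.b2n (g x y)) with (coloring_oracle g x y); auto.
  unfold coloring_oracle, colp. destruct (Nat.eqb_spec x y); [lia|].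
  destruct (Nat.ltb_spec x y); [|lia]. destruct (g x y); auto.
Qed.

(** Oscillation is demanded against the limit [b] that [g] has at [x]: it yields a lock, which
    hopelessness excludes, or a color other than [b] where [g] has settled. *)
Lemma limit_not_hopeless k : ~ hopeless (prog_at e) (fst (u k)).
Proof.
  intros [[x Hx]|[x [y [Hxy Hv]]]].
  - destruct (Hg x) as [b [N HN]].
    destruct (Hful (Oscillate e x (S N) b) k) as [m [Hm Ho]].
    pose proof (limit_extends k m Hm) as Em. pose proof (Hf m) as Hfm.
    unfold fulfills in Ho. destruct (u m) as [p S0]. simpl in *.
    destruct Ho as [[q [j [Eq Hl]]]|[y [HMy [Hxy Hy]]]].
    + apply (Hx q j); auto. eapply extends_trans; eauto.
    + destruct (Hy f Hfm) as [v [Hne Hv]]. apply Hne. rewrite <- (HN y); try lia.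
      eapply eval_functional; [exact Hv|]. apply limit_value; auto.
  - apply (Hv f (Nat.b2n (g x y))); auto. apply limit_value; auto.
Qed.

(** A stage containing a left element forces color [i] with all right elements present or still to
    come, and [f] meets that stage. Liveness activates [Grow]. *)
Lemma limit_solution i : (forall k, live (prog_at e) (fst (u k)) (snd (u k) e) i) ->
  inc_p_homogeneous g (limit_set e i).
Proof.
  intros Hlive.
  assert (Hreach : forall N, reaches (limit_set e i) N).
  { intros N. destruct (Hful (Grow e N i) 0) as [k [_ Hk]]. specialize (Hlive k).
    pose proof (limit_set_true e i) as Ht. unfold fulfills in Hk.
    destruct (u k) as [p S0] eqn:Eu. simpl in *.
    destruct (Hk Hlive) as [[x [Hx Ex]] [y [Hy Ey]]].
    split; [exists x|exists y]; split; auto; apply Ht; exists k; rewrite Eu; auto. }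
  split; [|split].
  - intros N. apply (Hreach N).
  - intros N. apply (Hreach N).
  - exists i. intros x r Hx Hr Hlt. unfold HL, HR in *.
    apply limit_set_true in Hx. destruct Hx as [k Hk].
    assert (Hfo : forces (prog_at e) (fst (u k)) x r i).
    { destruct (limit_set_compatible e i k) as [HC _].
      apply (proj2 (proj2 (Hok k e) i)); auto.
      destruct (le_lt_dec (bd (snd (u k) e)) (2 * r + 1)) as [L|L]; auto.
      left. rewrite <- HC; auto. }
    pose proof (Hfo f (Hf k) _ (limit_value x r Hlt)) as Hv.
    destruct (g x r), i; auto; discriminate.
Qed.

(** If each color either died or left a program unbeaten, one [Defeat] requirement for the two
    unbeaten programs, met after any deaths, would produce a color that is live and beats its
    program. *)
Lemma limit_diagonalizes : exists i, inc_p_homogeneous g (limit_set e i) /\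
  forall Hs, computes (set_oracle (limit_set e i)) (set_oracle Hs) -> ~ p_homogeneous f Hs.
Proof.
  set (alive := fun i => forall k, live (prog_at e) (fst (u k)) (snd (u k) e) i).
  set (beaten := fun i j => exists k, defeats (prog_at j) (fst (u k)) (snd (u k) e) i).
  assert (exists i, alive i /\ forall j, beaten i j) as [i [Hi Hb]].
  { apply NNPP. intros Hno.
    assert (Hside : forall i, exists K j,
      (forall k, K <= k -> ~ live (prog_at e) (fst (u k)) (snd (u k) e) i) \/ ~ beaten i j).
    { intros i. destruct (classic (alive i)) as [Ha|Ha].
      - destruct (not_all_ex_not _ (beaten i)) as [j Hj]; [|exists 0, j; auto].
        intros H. apply Hno. eauto.
      - apply not_all_ex_not in Ha. destruct Ha as [K HK]. exists K, 0. left.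
        intros k Hk Hl. apply HK. eapply live_mono; [| |exact Hl].
        + apply limit_extends; auto.
        + apply limit_side_extends; auto. }
    destruct (Hside false) as [K0 [j0 H0]]. destruct (Hside true) as [K1 [j1 H1]].
    destruct (Hful (Defeat e j0 j1) (K0 + K1)) as [k [Hk Hd]].
    pose proof (limit_not_hopeless k) as Hh.
    unfold beaten in *.
    unfold fulfills in Hd. destruct (u k) as [p S0] eqn:Eu. simpl in Hh.
    destruct Hd as [Hd|[[|] [Hl Hd]]]; [contradiction| |].
    - destruct H1 as [H1|H1].
      + apply (H1 k); [lia|]. rewrite Eu. exact Hl.
      + apply H1. exists k. rewrite Eu. exact Hd.
    - destruct H0 as [H0|H0].
      + apply (H0 k); [lia|]. rewrite Eu. exact Hl.
      + apply H0. exists k. rewrite Eu. exact Hd. }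
  exists i. split; [apply limit_solution; exact Hi|]. intros Hs [Psi HPsi].
  destruct (prog_at_surj Psi) as [j <-]. destruct (Hb j) as [k Hk].
  apply (Hk f (limit_set e i) Hs); auto. apply limit_set_compatible.
Qed.
End Limit.

Theorem theorem1p9 : ~ sc_reducible SPT22 SIPT22.
Proof.
  intros Hred.
  destruct (generic_sequence state state_extends state_ok
    (fun n => fulfills (requirement_at n))) with
    (s0 := (Cond 0 (fun _ _ => false) (fun _ => false),
      fun _ : nat => Side (fun _ _ => false) 0 (fun _ => True))) as [u [Hu Hful0]].
  - intros n s. apply fulfills_dense.
  - intros e. split.
    + split; intros N; exists N; simpl; auto.
    + intros i. split; simpl; discriminate.
  - assert (Hok : forall k, state_ok (u k)) by apply Hu.
    assert (Hstep : forall k, state_extends (u (S k)) (u k)) by apply Hu.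
    assert (Hful : forall r K, exists k, K <= k /\ fulfills r (u k)).
    { intros r K. destruct (requirement_at_surj r) as [n <-]. apply Hful0. }
    destruct (limit_coloring u Hstep Hful) as [f Hf].
    destruct (Hred f (limit_stable u Hful f Hf)) as [g [Hg [[Phi HPhi] Hsol]]].
    destruct (prog_at_surj Phi) as [e <-].
    destruct (limit_diagonalizes u Hok Hstep Hful f g e Hf Hg HPhi) as [i [Hinc Hno]].
    destruct (Hsol _ Hinc) as [Hs [Hc Hp]]. exact (Hno Hs Hc Hp).
Qed.
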